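(* There exist functions $\psi,\phi\in L^\infty_{loc}(\mathbb{R})$ such that $S_{2+\varepsilon}(\psi,\phi)=\infty$ for every $\varepsilon>0$, while the commutator $[\phi,[\psi,H]]$ is bounded on $L^2(\mathbb{R})$, where $H$ is the Hilbert transform.
   Context: The Hilbert transform is $Hf(x)=\lim_{\varepsilon\to0}\int_{|x-y|>\varepsilon}\frac{f(y)}{x-y}\,dy$. $[A,B]=AB-BA$, and a function acts by pointwise multiplication; the commutator is defined on $L^\infty_c(\mathbb{R})$ and bounded on $L^2$ means $\|[\phi,[\psi,H]]f\|_{2}\le K\|f\|_2$ for all $f\in L^\infty_c$. For $r>0$, with $\langle g\rangle_I=\frac1{|I|}\int_Ig$ and supremum over all intervals $I$: $S_r(b_1,b_2)=\sup_I\big(\frac1{|I|}\int_I|b_1-\langle b_1\rangle_I|^r\big)^{1/r}\big(\frac1{|I|}\int_I|b_2-\langle b_2\rangle_I|^r\big)^{1/r}$. *)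

(* Defs.v *)
From HB Require Import structures.
From mathcomp Require Import all_boot all_order all_algebra.
From mathcomp Require Import all_classical all_reals all_analysis.
Set Implicit Arguments. Unset Strict Implicit. Unset Printing Implicit Defensive.
Import Order.TTheory GRing.Theory Num.Theory.
Import numFieldNormedType.Exports.
Local Open Scope classical_set_scope.
Local Open Scope ring_scope.

Section Defs.
Variable R : realType.
Local Notation mu := (@lebesgue_measure R).

Definition Linf_loc (f : R -> R) : Prop :=
  measurable_fun setT f /\
  forall a b : R, exists M : R,
    {ae mu, forall x, x \in `[a, b] -> `|f x| <= M}.

Definition Linf_c (f : R -> R) : Prop :=
  measurable_fun setT f /\
  (exists M : R, {ae mu, forall x, `|f x| <= M}) /\
  (exists a b : R, forall x, x \notin `[a, b] -> f x = 0).

Definition hilbert (f : R -> R) (x : R) : R :=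
  lim ((fun eps : R =>
          Rintegral mu [set y | eps < `|x - y|] (fun y => f y / (x - y)))
       @ 0^'+).

Definition commH (psi : R -> R) (f : R -> R) : R -> R :=
  fun x => psi x * hilbert f x - hilbert (fun y => psi y * f y) x.

Definition commH2 (phi psi : R -> R) (f : R -> R) : R -> R :=
  fun x => phi x * commH psi f x - commH psi (fun y => phi y * f y) x.

Definition avg (b : R -> R) (a c : R) : R :=
  (c - a)^-1 * Rintegral mu `[a, c] b.

Definition osc (r : R) (b : R -> R) (a c : R) : R :=
  ((c - a)^-1 * Rintegral mu `[a, c] (fun x => `|b x - avg b a c| `^ r))
    `^ r^-1.

Definition S_r (r : R) (b1 b2 : R -> R) : \bar R :=
  ereal_sup [set v : \bar R | exists a c : R,
             a < c /\ v = ((osc r b1 a c * osc r b2 a c)%:E)].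

Definition bounded_L2_on_Linf_c (T : (R -> R) -> (R -> R)) : Prop :=
  exists K : R, forall f, Linf_c f ->
    (Lnorm mu 2%:E (EFin \o T f) <= K%:E * Lnorm mu 2%:E (EFin \o f))%E.

End Defs.

(* Main.v *)
(** Let [spike P] be the step function equal to [height k] on the interval
    [[k, k + width k]] for each [k] satisfying [P], and to [0] elsewhere, where
    [height k ^+ 2 * width k] is summable while [height k `^ (2 + eps) * width k]
    grows faster than any polynomial in [k] for every [eps > 0]. Take [psi] with
    the odd spikes and [phi] with the even ones: both are in [L^2], with disjoint
    supports at distance at least [1/2] from each other.

    Since [phi * psi = 0], the commutator is
    [- phi H(psi f) - psi H(phi f)]. On the support of [phi] the kernel of
    [H(psi f)] is bounded by [2], so Cauchy-Schwarz bounds [H(psi f)] by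
    [2 |psi|_2 |f|_2], and symmetrically; as [phi] and [psi] are in [L^2] the
    commutator is bounded on [L^2]. On [[0, 2m + 2]] the spikes of index [2m] and
    [2m + 1] make both oscillations of order [2 + eps] tend to infinity. *)
Require Import Defs.
From HB Require Import structures.
From mathcomp Require Import all_boot all_order all_algebra.
From mathcomp Require Import all_classical all_reals all_analysis.
From mathcomp Require Import measurable_realfun ring lra.
Set Implicit Arguments. Unset Strict Implicit. Unset Printing Implicit Defensive.
Import Order.TTheory GRing.Theory Num.Theory.
Import numFieldNormedType.Exports.
Local Open Scope classical_set_scope.
Local Open Scope ring_scope.

(** * Measurability of the inverse, monotonicity and homogeneity of norms *)

Lemma measurable_invr (R : realType) : measurable_fun setT (@GRing.inv R).
Proof.
(* This formula, valid at [0] as well, reduces the claim to products of measurable functions built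
   from [powR]. *)
have -> : @GRing.inv R = fun x => x * (`|x| `^ (-1) * `|x| `^ (-1)).
  apply/funext => x; rewrite powR_inv1// -invfM -expr2 real_normK ?num_real//.
  have [->|x0] := eqVneq x 0; first by rewrite invr0 mul0r.
  by rewrite expr2 invfM mulrA divff// mul1r.
have mp : measurable_fun setT (fun x : R => `|x| `^ (-1)).
  apply: (@measurableT_comp _ _ _ _ _ _ (@powR R ^~ (-1))).
    exact: measurable_powR.
  exact: normr_measurable.
by apply: measurable_funM => //; exact: measurable_funM.
Qed.

(* [f] need not be measurable: this avoids proving the measurability of the
   commutator, for which only a pointwise upper bound is available. *)
Lemma ge0_le_integral_nonmeasurable d (T : measurableType d) (R : realType)
    (mu : {measure set T -> \bar R}) (f g : T -> \bar R) :
  (forall x, 0 <= f x)%E -> (forall x, f x <= g x)%E ->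
  (\int[mu]_x f x <= \int[mu]_x g x)%E.
Proof.
move=> f0 fg; have g0 x : (0 <= g x)%E by exact: le_trans (fg x).
rewrite !ge0_integralTE//; apply: le_ereal_sup => _ /= [s sf <-].
by exists s => // x; exact: le_trans (fg x).
Qed.

Lemma le_Lnorm d (T : measurableType d) (R : realType)
    (mu : {measure set T -> \bar R}) (p : R) (f g : T -> \bar R) :
  0 < p -> (forall x, `|f x| <= `|g x|)%E ->
  (Lnorm mu p%:E f <= Lnorm mu p%:E g)%E.
Proof.
move=> p0 fg; rewrite unlock; apply: gt0_ler_poweR.
- by rewrite invr_ge0 ltW.
- by rewrite in_itv/= leey andbT integral_ge0// => x _; exact: poweR_ge0.
- by rewrite in_itv/= leey andbT integral_ge0// => x _; exact: poweR_ge0.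
apply: ge0_le_integral_nonmeasurable => x; first by rewrite poweR_ge0.
apply: gt0_ler_poweR; rewrite ?in_itv/= ?leey ?abse_ge0 ?(ltW p0) ?fg//.
Qed.

Lemma LnormZ_EFin d (T : measurableType d) (R : realType)
    (mu : {measure set T -> \bar R}) (p c : R) (f : T -> R) :
  0 < p -> measurable_fun setT f ->
  Lnorm mu p%:E (fun x => (c * f x)%:E) = (`|c|%:E * Lnorm mu p%:E (EFin \o f))%E.
Proof.
move=> p0 mf; rewrite unlock.
under eq_integral => x _ do rewrite EFinM abseM poweRM//.
rewrite ge0_integralZl//=; last first.
  apply/measurable_EFinP.
  apply: (@measurableT_comp _ _ _ _ _ _ (@powR R ^~ p)).
    exact: measurable_powR.
  exact: measurableT_comp.
rewrite poweRM ?lee_fin ?powR_ge0 ?integral_ge0//.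
by rewrite poweR_EFin -powRrM mulfV ?gt_eqF// powRr1.
Qed.

(** * The Hilbert transform off the support, and commutators of functions with zero product *)

Section hilbert_off_support.
Variable R : realType.
Local Notation mu := (@lebesgue_measure R).
Implicit Types (u v f phi psi : R -> R) (x c : R).

(** Once [eps < c], truncation removes only points where [u] vanishes, so the limit is that of an
    eventually constant function. *)
Lemma hilbert_off_support u x c : 0 < c ->
  (forall y, `|x - y| < c -> u y = 0) ->
  hilbert u x = Rintegral mu setT (fun y => u y / (x - y)).
Proof.
move=> c0 u0; rewrite /hilbert; apply: norm_lim_near_cst; near=> e.
rewrite Rintegral_mkcond; apply: eq_Rintegral => y _.
rewrite patchE; case: ifPn => //; rewrite notin_setE/= => /negP.
rewrite -leNgt => xye; rewrite u0 ?mul0r//.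
rewrite (le_lt_trans xye)//; near: e; exact: nbhs_right_lt.
Unshelve. all: by end_near. Qed.

Lemma hilbert0 x : hilbert (fun=> 0) x = 0.
Proof.
rewrite (@hilbert_off_support _ _ 1)//.
by under eq_Rintegral do rewrite mul0r; rewrite Rintegral_cst// mul0r.
Qed.

Lemma norm_hilbert_le u x c : 0 < c ->
  (forall y, `|x - y| < c -> u y = 0) ->
  mu.-integrable setT (EFin \o u) ->
  `|hilbert u x| <= c^-1 * Rintegral mu setT (fun y => `|u y|).
Proof.
move=> c0 u0 iu; rewrite (hilbert_off_support c0 u0).
have mu_ : measurable_fun setT u by apply/measurable_EFinP; case/integrableP: iu.
have le_ y : `|u y / (x - y)| <= c^-1 * `|u y|.
  have [xyc|cxy] := ltP `|x - y| c; first by rewrite u0// !mul0r normr0 mulr0.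
  rewrite normrM normfV mulrC ler_wpM2r// lef_pV2// posrE//.
  exact: lt_le_trans cxy.
have icu : mu.-integrable setT (EFin \o (fun y => c^-1 * `|u y|)).
  have -> : EFin \o (fun y => c^-1 * `|u y|) =
            (fun y => (c^-1)%:E * `|(EFin \o u) y|)%E by [].
  by apply: integrableZl => //; exact: integrable_abse.
have iq : mu.-integrable setT (EFin \o (fun y => u y / (x - y))).
  apply: le_integrable icu => //.
    apply/measurable_EFinP; apply: measurable_funM => //.
    apply: (measurableT_comp (@measurable_invr R)).
    exact: measurable_funB.
  by move=> y _ /=; rewrite lee_fin (le_trans (le_ y))// ler_norm.
rewrite (le_trans (le_normr_Rintegral _ iq))//.
rewrite -RintegralZl//; last exact: (integrable_abse iu).
apply: le_Rintegral => //; exact: (integrable_abse iq).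
Qed.

(** Of the four terms of the expansion, [phi * psi * H f] and [H (psi * phi * f)] vanish. *)
Lemma commH2_disjoint phi psi f x : (forall y, phi y * psi y = 0) ->
  commH2 phi psi f x = - (phi x * hilbert (fun y => psi y * f y) x)
                       - psi x * hilbert (fun y => phi y * f y) x.
Proof.
move=> pp; rewrite /commH2 /commH.
have -> : (fun y => psi y * (phi y * f y)) = fun=> 0.
  by apply/funext => y; rewrite mulrA (mulrC (psi y)) pp mul0r.
by rewrite hilbert0 subr0 mulrBr mulrA pp mul0r sub0r.
Qed.

Lemma integrable_mul_L2 u v : measurable_fun setT u -> measurable_fun setT v ->
  (Lnorm mu 2%:E (EFin \o u) < +oo)%E -> (Lnorm mu 2%:E (EFin \o v) < +oo)%E ->
  mu.-integrable setT (EFin \o (fun y => u y * v y)) /\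
  ((Rintegral mu setT (fun y => `|u y * v y|))%:E <=
   Lnorm mu 2%:E (EFin \o u) * Lnorm mu 2%:E (EFin \o v))%E.
Proof.
move=> mu_ mv nu nv.
have := @hoelder _ _ _ mu u v 2 2 mu_ mv.
rewrite Lnorm1 !ltr0n => /(_ isT isT) H; have {H} : (\int[mu]_x `|(u x * v x)%:E| <=
   Lnorm mu 2%:E (EFin \o u) * Lnorm mu 2%:E (EFin \o v))%E.
  by apply: H; lra.
move=> H; have fin : (\int[mu]_x `|(u x * v x)%:E| < +oo)%E.
  apply: le_lt_trans H _; rewrite lte_mul_pinfty ?Lnorm_ge0//.
  by rewrite ge0_fin_numE ?Lnorm_ge0.
split.
  apply/integrableP; split => //; apply/measurable_EFinP; exact: measurable_funM.
by rewrite /Rintegral fineK// ge0_fin_numE// integral_ge0.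
Qed.

End hilbert_off_support.

(** * Lower bound for the oscillation *)

Section osc_lower_bound.
Variable R : realType.
Local Notation mu := (@lebesgue_measure R).

(** The integral is bounded below by its part over a single interval of length [d]. The bound [M]
    ensures integrability; the real-valued integral would be [0] if the integral were infinite. *)
Lemma osc_ge (r : R) (b : R -> R) (a c h d s t M : R) :
  0 < r -> a < c -> 0 <= h -> 0 < d -> measurable_fun setT b ->
  (forall x, a <= x <= c -> `|b x| <= M) ->
  a <= s -> s + d <= c -> a <= t -> t + d <= c ->
  (forall x, s <= x <= s + d -> b x = h) ->
  (forall x, t <= x <= t + d -> b x = 0) ->
  h / 2 * ((c - a)^-1 * d) `^ r^-1 <= osc r b a c.
Proof.
move=> r0 ac h0 d0 mb bM as_ sc at_ tc bh b0; rewrite /osc.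
set m := avg b a c.
(* Whatever the mean [m] is, [h] or [0] is at distance at least [h / 2] from it. *)
have [z az [zc bz]] : exists2 z, a <= z & z + d <= c /\
    forall x, z <= x <= z + d -> h / 2 <= `|b x - m|.
  have [hm|hm] := leP (h / 2) `|m|.
    exists t => //; split => // x xt; by rewrite b0// sub0r normrN.
  exists s => //; split => // x xs; rewrite bh//.
  by move: hm; rewrite !ltr_norml ler_normr => /andP[? ?]; apply/orP; left; lra.
have ca0 : 0 < (c - a)^-1 by rewrite invr_gt0 subr_gt0.
have hd : (h / 2) `^ r * d <= \int[mu]_(x in `[a, c]) (`|b x - m| `^ r).
  have -> : (h / 2) `^ r * d =
      \int[mu]_(x in `[a, c]) (cst ((h / 2) `^ r) \_ `[z, z + d]) x.
    rewrite -Rintegral_mkcondr setIidr; last first.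
      by move=> x /=; rewrite !in_itv/= => /andP[? ?]; apply/andP; split; lra.
    rewrite Rintegral_cst//= lebesgue_measure_itv/= lte_fin ltrDl d0.
    by rewrite -EFinB/= addrAC subrr add0r.
  have fin : (mu `[a, c] < +oo)%E.
    by rewrite lebesgue_measure_itv/= lte_fin ac -EFinB ltry.
  have mbm : measurable_fun setT (fun x => `|b x - m| `^ r).
    apply: (@measurableT_comp _ _ _ _ _ _ (@powR R ^~ r)).
      exact: measurable_powR.
    by apply: measurableT_comp => //; exact: measurable_funB.
  apply: le_Rintegral => //.
  - apply: measurable_bounded_integrable => //.
      apply/measurable_funTS/(measurable_restrictT _ _).1 => //.
    exists ((h / 2) `^ r); split; first exact: num_real.
    move=> y hy x _ /=; rewrite patchE; apply: ltW; case: ifPn => _.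
      by rewrite ger0_norm ?powR_ge0.
    by rewrite normr0 (le_lt_trans _ hy)// powR_ge0.
  - apply: measurable_bounded_integrable => //; first exact: measurable_funTS.
    exists ((M + `|m|) `^ r); split; first exact: num_real.
    move=> y hy x /=; rewrite in_itv/= => xac; rewrite ger0_norm ?powR_ge0// (le_trans _ (ltW hy))//.
    have M0 : 0 <= M by apply: le_trans (bM a _) => //; rewrite lexx ltW.
    rewrite ge0_ler_powR ?nnegrE ?(ltW r0) ?addr_ge0//.
    by rewrite (le_trans (ler_normB _ _))// lerD2r bM.
  - move=> x _; rewrite patchE; case: ifPn => xz; last exact: powR_ge0.
    rewrite ge0_ler_powR ?nnegrE ?(ltW r0) ?divr_ge0//.
    by apply: bz; move: xz; rewrite inE/= in_itv.
have -> : h / 2 = ((h / 2) `^ r) `^ r^-1.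
  by rewrite -powRrM mulfV ?gt_eqF// powRr1// divr_ge0.
have [[ca1 d1] r1] := (ltW ca0, ltW d0, ltW r0).
rewrite -powRM ?powR_ge0 ?mulr_ge0//.
rewrite ge0_ler_powR ?nnegrE ?invr_ge0 ?mulr_ge0 ?powR_ge0//.
  by apply: Rintegral_ge0 => x _; exact: powR_ge0.
by rewrite mulrCA ler_wpM2l.
Qed.

End osc_lower_bound.

(** * Spike functions: separation, norm and growth of the oscillations *)

Section spike.
Variable R : realType.
Local Notation mu := (@lebesgue_measure R).
Implicit Types (P : pred nat) (x y : R) (k n : nat).

(** The exponent is quadratic in [k] so that any fixed positive power of the height outgrows every
    geometric sequence. *)
Definition height k : R := 4 ^+ (k.+1 * k).

(** Normalised so that [height k ^+ 2 * width k] is [2 ^- k.+2], with sum [1/2]. *)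
Definition width k : R := (2 ^+ k.+2)^-1 / height k ^+ 2.

(** The truncation of [x] is the only index whose spike can contain [x]. It is [0] for negative [x],
    hence the separate sign test. *)
Definition spike P x : R :=
  let k := Num.truncn x in
  if [&& 0 <= x, x <= k%:R + width k & P k] then height k else 0.

Lemma height_ge1 k : 1 <= height k.
Proof. by rewrite exprn_ege1// ler1n. Qed.

Lemma height_gt0 k : 0 < height k.
Proof. exact: lt_le_trans (height_ge1 k). Qed.

Lemma height_le k n : (k <= n)%N -> height k <= height n.
Proof. by move=> kn; rewrite ler_eXn2l ?ltr1n// leq_mul. Qed.

Lemma width_gt0 k : 0 < width k.
Proof. by rewrite divr_gt0 ?invr_gt0 ?exprn_gt0 ?height_gt0. Qed.

Lemma width_le k : width k <= 4^-1.
Proof.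
rewrite /width ler_pdivrMr ?exprn_gt0 ?height_gt0//.
apply: (@le_trans _ _ 4^-1).
  rewrite lef_pV2 ?posrE ?exprn_gt0// !exprS mulrA -natrM.
  by rewrite ler_peMr// exprn_ege1// ler1n.
by rewrite ler_peMr ?invr_ge0// exprn_ege1// height_ge1.
Qed.

(** The right-hand side has the shape of the terms summed by [epsilon_trick0]. *)
Lemma height_sqr_width k : height k ^+ 2 * width k = 2^-1 / (2 ^ k.+1)%:R.
Proof.
rewrite /width mulrCA mulfV ?mulr1 ?natrX -?invfM -?exprS//.
by rewrite expf_neq0// gt_eqF// height_gt0.
Qed.

Lemma spike_ge0 P x : 0 <= spike P x.
Proof. by rewrite /spike; case: ifP => // _; rewrite ltW// height_gt0. Qed.

Lemma spikeE P x k : k%:R <= x < k.+1%:R ->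
  spike P x = if (x <= k%:R + width k) && P k then height k else 0.
Proof.
move=> kx; rewrite /spike (truncn_def kx).
by have /andP[+ _] := kx => /(le_trans (ler0n _ _)) ->.
Qed.

Lemma spike_lt0 P x : x < 0 -> spike P x = 0.
Proof. by move=> x0; rewrite /spike leNgt x0. Qed.

Lemma spike_neq0 P x : spike P x != 0 ->
  exists k, [/\ P k, k%:R <= x, x <= k%:R + width k & spike P x = height k].
Proof.
rewrite /spike; case: ifPn => [/and3P[x0 xk Pk] _|]; last by rewrite eqxx.
by exists (Num.truncn x); split => //; rewrite truncn_le.
Qed.

Lemma spike_le P x n : x <= n%:R -> spike P x <= height n.
Proof.
move=> xn; have [->|/spike_neq0[k [_ kx _ ->]]] := eqVneq (spike P x) 0.
  by rewrite ltW// height_gt0.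
by apply: height_le; rewrite -(ler_nat R) (le_trans kx).
Qed.

(** Widths are at most [1/4], so spikes of distinct indices are at least [3/4] apart. *)
Lemma spike_predC_near P x y : spike P x != 0 -> `|x - y| < 2^-1 ->
  spike (predC P) y = 0.
Proof.
move=> /spike_neq0[k [Pk kx xk _]]; rewrite ltr_norml => /andP[xy1 xy2].
apply/eqP/negPn/negP => /spike_neq0[l [Pl ly yl _]].
have := width_le k; have := width_le l => wl wk.
have [kl|lk|kl] := ltngtP k l; last by rewrite kl/= in Pk Pl; rewrite /= Pk in Pl.
- by move: kl; rewrite -(ler_nat R) -natr1; lra.
- by move: lk; rewrite -(ler_nat R) -natr1; lra.
Qed.

Lemma spike_predC_disjoint P x : spike P x * spike (predC P) x = 0.
Proof.
have [->|Px] := eqVneq (spike P x) 0; first by rewrite mul0r.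
by rewrite (spike_predC_near Px) ?mulr0// subrr normr0.
Qed.

Lemma measurable_spike P : measurable_fun setT (spike P).
Proof.
(* On each of these countably many pieces the function is constant or a simple threshold
   function. *)
pose E k : set R := if k is n.+1 then `[n%:R, n.+1%:R[%classic else `]-oo, 0[%classic.
have -> : [set: R] = \bigcup_k E k.
  apply/seteqP; split => // x _.
  have [x0|x0] := leP 0 x; last by exists 0%N; rewrite //= in_itv.
  by exists (Num.truncn x).+1 => //=; rewrite in_itv/= truncn_itv.
apply/measurable_fun_bigcup; first by case => [|n]; exact: measurable_itv.
case=> [|n].
  apply: (eq_measurable_fun (cst 0 : R -> R)) => // x; rewrite inE/= in_itv/= => x0.
  by rewrite spike_lt0.
apply: (eq_measurable_fun
    (fun x : R => if (x <= n%:R + width n) && P n then height n else 0)).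
  by move=> x; rewrite inE/= in_itv/= => /spikeE ->.
apply: measurable_funTS; apply: measurable_fun_ifT => //.
by apply: measurable_and => //; exact: measurable_fun_ler.
Qed.

(** Whatever [P], the square is dominated by the sum of [height k ^+ 2] times the indicator of the
    [k]-th spike; termwise integration gives at most [1/2]. *)
Lemma Lnorm_spike_le1 P : (Lnorm mu 2%:E (EFin \o spike P) <= 1)%E.
Proof.
rewrite unlock -(@poweR1r R 2^-1); apply: gt0_ler_poweR => //.
- by rewrite in_itv/= leey andbT integral_ge0// => x _; exact: poweR_ge0.
- by rewrite in_itv/= leey lee01.
pose A k : set R := `[k%:R, k%:R + width k]%classic.
have mA k : measurable (A k) by exact: measurable_itv.
pose F k x : \bar R := (height k ^+ 2 * \1_(A k) x)%:E.
have F0 k x : (0 <= F k x)%E.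
  by rewrite lee_fin mulr_ge0 ?sqr_ge0.
apply: (@le_trans _ _ (\int[mu]_x \sum_(k <oo) F k x)%E).
  apply: ge0_le_integral_nonmeasurable => x; first exact: poweR_ge0.
  rewrite /= ger0_norm ?spike_ge0// powR_mulrn ?spike_ge0//.
  have [->|/spike_neq0[k [_ kx xk ->]]] := eqVneq (spike P x) 0.
    by rewrite expr0n/=; exact: nneseries_ge0.
  apply: le_trans (@nneseries_lim_ge R (F^~ x) xpredT 0 k.+1 (fun n _ _ => F0 n x)).
  rewrite big_nat_recr//= -[leLHS]add0e leeD//; first exact: sume_ge0.
  have Akx : A k x by rewrite /A/= in_itv/= kx.
  by rewrite lee_fin indicE mem_set// mulr1.
rewrite integral_nneseries//; last first.
  move=> k; apply/measurable_EFinP; apply: measurable_funM => //.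
  exact: measurable_indic (mA k).
have half_ge0 : 0 <= 2^-1 :> R by rewrite invr_ge0.
have half_le1 : (2^-1%:E <= 1 :> \bar R)%E by rewrite lee_fin invf_le1// ler1n.
apply: le_trans half_le1; apply: le_trans (epsilon_trick0 xpredT half_ge0).
apply: lee_nneseries => [k _ _|k _]; first exact: integral_ge0.
rewrite -height_sqr_width /F.
under eq_integral => x _ do rewrite EFinM.
rewrite ge0_integralZl//; last 2 first.
- by apply/measurable_EFinP; exact: measurable_indic (mA k).
- by rewrite lee_fin sqr_ge0.
rewrite integral_indic//; last exact: mA.
rewrite setIT/= /A lebesgue_measure_itv/= lte_fin ltrDl width_gt0.
by rewrite -EFinB addrAC subrr add0r.
Qed.

Lemma osc_spike_ge P (r : R) k n : 0 < r -> P k -> (k < n)%N ->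
  height k / 2 * (n%:R^-1 * width k) `^ r^-1 <= osc r (spike P) 0 n%:R.
Proof.
move=> r0 Pk kn; have -> : n%:R^-1 = (n%:R - 0)^-1 :> R by rewrite subr0.
have kn1 : k%:R + 1 <= n%:R :> R by rewrite natr1 ler_nat.
have k0 : 0 <= k%:R :> R by [].
have [w0 w1] := (width_gt0 k, width_le k).
(* The zero interval starts at [k + 1/2]: since [width k <= 1/4], it lies beyond the spike and
   before [k + 1 <= n]. *)
apply: (@osc_ge _ _ _ _ _ _ _ k%:R (k%:R + 2^-1) (height n)) => //.
- by rewrite ltr0n (leq_trans _ kn).
- by rewrite ltW// height_gt0.
- exact: measurable_spike.
- by move=> x /andP[_ xn]; rewrite ger0_norm ?spike_ge0// spike_le.
- by lra.
- by lra.
- move=> x /andP[kx xk]; rewrite (@spikeE _ _ k) ?xk ?Pk// -natr1.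
  by apply/andP; split; lra.
- move=> x /andP[kx xk]; rewrite (@spikeE _ _ k); last first.
    by rewrite -natr1; apply/andP; split; lra.
  by case: ifPn => // /andP[xk' _]; exfalso; lra.
Qed.

(* Once [k * eps >= 2], [height k `^ eps] is at least [16 ^+ k.+1], which absorbs
   both [height k ^+ 2 * width k = 2 ^- k.+2] and the interval length [n]. *)
Lemma osc_spike_unbounded P (eps C : R) : 0 < eps -> exists n0, forall k n,
  (n0 <= k)%N -> P k -> (k < n <= k.+2)%N -> C <= osc (2 + eps) (spike P) 0 n%:R.
Proof.
move=> e0; set r := 2 + eps; have r0 : 0 < r by rewrite addr_gt0.
(* The first summand gives [k * eps >= 2]; the second makes [k] exceed the [r]-th power of
   [2 * |C|], where [2] offsets the halved height. *)
exists (Num.truncn (2 / eps + (2 * `|C|) `^ r)).+1 => k n k_ge Pk /andP[kn nk].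
have k_gt : 2 / eps + (2 * `|C|) `^ r < k%:R.
  by rewrite (lt_le_trans (truncnS_gt _))// ler_nat.
have ke : 2 <= k%:R * eps.
  rewrite -ler_pdivrMr// (le_trans _ (ltW k_gt))// lerDl powR_ge0//.
have kC : (2 * `|C|) `^ r <= k%:R.
  by rewrite (le_trans _ (ltW k_gt))// lerDr divr_ge0// ltW.
apply: le_trans (osc_spike_ge r0 Pk kn).
pose q : R := 4 ^+ k.+1.
have q_ge1 : 1 <= q by rewrite exprn_ege1// ler1n.
have q0 : 0 <= q by exact: le_trans q_ge1.
have hq : q ^+ 2 <= height k `^ eps.
  rewrite /height exprM -/q -(powR_mulrn 2 q0) -(powR_mulrn k q0) -powRrM.
  exact: ler_powR.
have n0 : 0 < n%:R :> R by rewrite ltr0n (leq_trans _ kn).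
have nq : n%:R * 2 ^+ k.+2 <= 2 * q.
  rewrite /q -!natrX -!natrM ler_nat -[4%N]/(2 * 2)%N expnMn mulnA -expnS mulnC.
  by rewrite leq_mul2l (leq_trans nk) ?orbT// ltn_expl.
have kq : k%:R * 2 <= q.
  by rewrite /q -natrX -natrM ler_nat expnSr leq_mul// ltnW// ltn_expl.
(* One factor of [q ^+ 2] pays for [n * 2 ^+ k.+2 <= 2 * q], the other for [2 * k <= q]. *)
have main : k%:R <= height k `^ r * (n%:R^-1 * width k).
  have -> : height k `^ r * (n%:R^-1 * width k) =
            height k `^ eps / (n%:R * 2 ^+ k.+2).
    rewrite /r powRD ?gt_eqF ?height_gt0 ?implybT//.
    rewrite powR_mulrn ?(ltW (height_gt0 k))// /width; field.
    by rewrite !gt_eqF ?height_gt0 ?exprn_gt0.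
  have d0 : 0 < n%:R * 2 ^+ k.+2 :> R by apply: mulr_gt0 => //; exact: exprn_gt0.
  rewrite ler_pdivlMr//.
  apply: le_trans hq; rewrite expr2.
  by rewrite (le_trans (ler_wpM2l _ nq))// mulrA ler_wpM2r.
have -> : height k = (height k `^ r) `^ r^-1.
  by rewrite -powRrM mulfV ?gt_eqF// powRr1// ltW// height_gt0.
rewrite mulrAC -powRM ?powR_ge0//; last by rewrite mulr_ge0 ?invr_ge0// ltW// width_gt0.
rewrite ler_pdivlMr// (le_trans (ler_norm _))// normrM mulrC (ger0_norm (ler0n _ 2)).
have -> : 2 * `|C| = ((2 * `|C|) `^ r) `^ r^-1.
  by rewrite -powRrM mulfV ?gt_eqF// powRr1// mulr_ge0.
rewrite ge0_ler_powR ?nnegrE ?invr_ge0 ?(ltW r0) ?powR_ge0//.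
  by rewrite mulr_ge0 ?powR_ge0// mulr_ge0 ?invr_ge0// ltW// width_gt0.
exact: le_trans main.
Qed.

End spike.

(** * Boundedness of the commutator and divergence of the oscillation product *)

Section commutator_bound.
Variable R : realType.
Local Notation mu := (@lebesgue_measure R).
Implicit Types (P Q : pred nat) (f : R -> R) (x : R).

Lemma le_spike_predT P x : spike P x <= spike xpredT x.
Proof.
have [->|/spike_neq0[k [_ kx xk ->]]] := eqVneq (spike P x) 0; first exact: spike_ge0.
rewrite (@spikeE _ xpredT x k) ?xk// kx/= -natr1.
by have := width_le R k; lra.
Qed.

Lemma norm_hilbert_spike P f x : measurable_fun setT f ->
  (Lnorm mu 2%:E (EFin \o f) < +oo)%E ->
  (forall y, `|x - y| < 2^-1 -> spike P y = 0) ->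
  `|hilbert (fun y => spike P y * f y) x| <= 2 * fine (Lnorm mu 2%:E (EFin \o f)).
Proof.
move=> mf nf P0; have nP := Lnorm_spike_le1 R P.
have [iPf Pf] := integrable_mul_L2 (measurable_spike P) mf
  (le_lt_trans nP (ltry 1)) nf.
have half_gt0 : 0 < 2^-1 :> R by rewrite invr_gt0.
apply: le_trans (norm_hilbert_le half_gt0 _ iPf) _.
  by move=> y /P0 ->; rewrite mul0r.
have nfE : (fine (Lnorm mu 2%:E (EFin \o f)))%:E = Lnorm mu 2%:E (EFin \o f).
  by rewrite fineK// ge0_fin_numE ?Lnorm_ge0.
rewrite invrK ler_wpM2l// -lee_fin nfE.
by apply: le_trans Pf _; rewrite -[leRHS]mul1e lee_wpmul2r ?Lnorm_ge0.
Qed.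

(** At each [x] at most one of the two spike functions is nonzero, so at most one term survives;
    [spike xpredT] majorises both functions. *)
Lemma norm_commH2_spike P f x : measurable_fun setT f ->
  (Lnorm mu 2%:E (EFin \o f) < +oo)%E ->
  `|commH2 (spike (predC P)) (spike P) f x| <=
  2 * fine (Lnorm mu 2%:E (EFin \o f)) * spike xpredT x.
Proof.
move=> mf nf; set N := fine _.
have N0 : 0 <= 2 * N by rewrite mulr_ge0// fine_ge0// Lnorm_ge0.
rewrite commH2_disjoint; last by move=> y; rewrite mulrC spike_predC_disjoint.
have bound Q Q' : (forall y, `|x - y| < 2^-1 -> spike Q' y = 0) ->
    `|spike Q x * hilbert (fun y => spike Q' y * f y) x| <= 2 * N * spike xpredT x.
  move=> Q'0; rewrite normrM (ger0_norm (spike_ge0 _ _)) mulrC.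
  apply: ler_pM; rewrite ?spike_ge0 ?le_spike_predT//.
  exact: norm_hilbert_spike.
have [Px0|Px] := eqVneq (spike P x) 0.
  rewrite Px0 mul0r subr0 normrN.
  have [->|PCx] := eqVneq (spike (predC P) x) 0.
    by rewrite mul0r normr0 mulr_ge0 ?spike_ge0.
  apply: bound => y xy; apply/eqP/negPn/negP => Py; move: PCx.
  by rewrite (spike_predC_near Py) ?eqxx// distrC.
have := spike_predC_disjoint P x => /eqP; rewrite mulf_eq0 (negbTE Px)/= => /eqP ->.
rewrite mul0r oppr0 sub0r normrN; apply: bound => y xy.
exact: spike_predC_near Px xy.
Qed.

Lemma bounded_commH2_spike P :
  bounded_L2_on_Linf_c (commH2 (@spike R (predC P)) (spike P)).
Proof.
(* The constant is the inverse of the separation [1/2], all spike norms being at most [1]. When [f]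
   has infinite norm the bound is trivial. *)
exists 2 => f [mf _]; have [nf|nf] := ltP (Lnorm mu 2%:E (EFin \o f)) +oo%E; last first.
  have -> : Lnorm mu 2%:E (EFin \o f) = +oo%E by apply/eqP; rewrite eq_le leey.
  by rewrite gt0_muley ?lte_fin// leey.
have nfE : (fine (Lnorm mu 2%:E (EFin \o f)))%:E = Lnorm mu 2%:E (EFin \o f).
  by rewrite fineK// ge0_fin_numE ?Lnorm_ge0.
have N0 : 0 <= fine (Lnorm mu 2%:E (EFin \o f)) by rewrite fine_ge0// Lnorm_ge0.
set N := fine _ in nfE N0 *.
apply: (@le_trans _ _ (Lnorm mu 2%:E (fun x => (2 * N * spike xpredT x)%:E))).
  apply: le_Lnorm => // x; rewrite /= lee_fin (le_trans _ (ler_norm _))//.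
  exact: norm_commH2_spike.
rewrite LnormZ_EFin//; last exact: measurable_spike.
rewrite ger0_norm ?mulr_ge0// EFinM nfE -[leRHS]mule1 lee_wpmul2l ?Lnorm_spike_le1//.
by rewrite mule_ge0 ?lee_fin ?Lnorm_ge0.
Qed.

Lemma Linf_loc_spike P : Linf_loc (@spike R P).
Proof.
split=> [|a b]; first exact: measurable_spike.
exists (height R (Num.truncn b).+1); apply: nearW => x; rewrite in_itv/= => /andP[_ xb].
by rewrite ger0_norm ?spike_ge0// spike_le// (le_trans xb)// ltW// truncnS_gt.
Qed.

Lemma S_r_spike (eps : R) : 0 < eps ->
  S_r (2 + eps) (spike odd) (spike (predC odd)) = +oo%E.
Proof.
(* Taking [D >= 1] gives [D * D >= D >= C], even for negative [C]. *)
move=> e0; apply: eq_infty => C; pose D := Num.max 1 C.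
have [n1 H1] := @osc_spike_unbounded R odd eps D e0.
have [n2 H2] := @osc_spike_unbounded R (predC odd) eps D e0.
(* The spikes used are those of index [n - 1], which is odd, and [n - 2], which is even. *)
pose m := maxn n1 n2; pose n := m.*2.+2.
have D1 : 1 <= D by rewrite le_max lexx.
have [m1 m2] : (n1 <= m.*2 /\ n2 <= m.*2)%N.
  by split; rewrite -addnn (leq_trans _ (leq_addr _ _))// leq_max leqnn ?orbT.
have h1 : D <= osc (2 + eps) (spike odd) 0 n%:R.
  apply: (H1 m.*2.+1); rewrite ?(leq_trans m1)//= ?odd_double//.
  by rewrite /n ltnSn/= ltnW.
have h2 : D <= osc (2 + eps) (spike (predC odd)) 0 n%:R.
  apply: (H2 m.*2) => //=; first by rewrite odd_double.
  by rewrite /n leqnn andbT.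
apply: (@le_trans _ _ (osc (2 + eps) (spike odd) 0 n%:R *
                       osc (2 + eps) (spike (predC odd)) 0 n%:R)%:E); last first.
  by apply: ereal_sup_ubound; exists 0, n%:R; rewrite ltr0n.
have D0 : 0 <= D by exact: le_trans D1.
rewrite lee_fin (@le_trans _ _ (D * D)) ?ler_pM//.
by rewrite (@le_trans _ _ D) ?ler_peMr// le_max lexx orbT.
Qed.

End commutator_bound.

Theorem theorem4p3 (R : realType) :
  exists psi phi : R -> R,
    Linf_loc psi /\ Linf_loc phi /\
    (forall eps : R, 0 < eps -> S_r (2 + eps) psi phi = +oo%E) /\
    bounded_L2_on_Linf_c (commH2 phi psi).
Proof.
exists (spike odd), (spike (predC odd)).
split; first exact: Linf_loc_spike.
split; first exact: Linf_loc_spike.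
by split; [exact: S_r_spike | exact: bounded_commH2_spike].
Qed.
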